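(* For every $k\ge0$, the root functional $\Phi_k(\xi):=x_o^k$, obtained from the local recursion initialized at zero, is continuous on the contractive marked-network space (the space $\widetilde{\mathcal G}_*$ with vertex-mark space $\mathcal T\times\mathbb R\times\mathsf F_{\mathrm c}$). In the nonexpansive regime (the space $\widetilde{\mathcal G}_*$ with vertex-mark space $\mathcal T\times\mathbb R\times\mathsf F_{\mathrm{ne}}$), the same holds, for every $k\geq 0$, for $\Phi_k^\pm(\xi):=x_o^{\pm,k}$, with initializations $x_v^{-,0}=0$ and $x_v^{+,0}=\mathfrak b(f_v)$.
   Context: **Marks.** $\mathcal T$ is a Polish space (of types) with a complete compatible metric. For a fixed $L\in[0,1)$, $\mathsf F_{\mathrm c}$ is the set of continuous nondecreasing $f:\mathbb R\to\mathbb R$ with $f(0)=0$ and Lipschitz constant at most $L$, with metric $d_{\mathrm c}(f,g)=\sum_{q\ge1}2^{-q}\bigl(1\wedge\sup_{|z|\le q}|f(z)-g(z)|\bigr)$. $\mathsf F_{\mathrm{ne}}$ is the set of bounded, nonnegative, nondecreasing, $1$-Lipschitz $f:\mathbb R\to\mathbb R$ with metric $\|f-g\|_\infty$, and $\mathfrak b(f):=\sup_zf(z)$. The vertex-mark space is $\mathsf M^V=\mathcal T\times\mathbb R\times\mathsf F_{\mathrm c}$ (contractive regime) or $\mathsf M^V=\mathcal T\times\mathbb R\times\mathsf F_{\mathrm{ne}}$ (nonexpansive regime), with a complete product metric $d_{\mathsf M^V}$; a vertex $v$ has mark $m_v=(\tau_v,\epsilon_v,f_v)$ (type, shock, response). The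 edge-mark space is $\mathsf M^E=(0,\infty)$ with $d_{\mathsf M^E}(c,c')=|\log c-\log c'|$; an edge $(v,u)$ has mark $C_{vu}>0$. **Rooted marked graphs and local topology.** A directed graph $G=(V,E)$ is forward locally finite if every vertex has finite out-degree. A rooted marked directed graph $(G,o,\mathcal M(G))$ is such a graph with a root $o\in V$ and marks $m_v\in\mathsf M^V$, $m_e\in\mathsf M^E$. An isomorphism is a vertex bijection preserving edges in both directions, the root, and all marks; $\mathcal G_*$ is the set of isomorphism classes. Let $d_G^+(o,v)$ be the length of a shortest directed path from $o$ to $v$ ($\infty$ if none), $V_k^+(o)=\{v:d_G^+(o,v)\le k\}$ and $E_k^+(o)=\{(v,u)\in E:d_G^+(o,v)<k\}$. For $\xi=[G,o,\mathcal M(G)]$, $[\xi]_k$ is the isomorphism class of the rooted marked graph with vertex set $V_k^+(o)$, edge set $E_k^+(o)$ and the original marks; $\mathfrak X_k$ is the set of such classes. Put $d_V=1\wedge d_{\mathsf M^V}$, $d_E=1\wedge d_{\mathsf M^E}$. For $a,b\in\mathfrak X_r$ let $d_r(a,b)=1$ if there is no root-preserving isomorphism of the underlying directed graphs (ignoring marks), and otherwise $d_r(a,b)=\min_\phi\max\{\max_v d_V(m_v,m'_{\phi(v)}),\max_{(v,u)}d_E(m_{(v,u)},m'_{(\phi(v),\phi(u))})\}$ over such isomorphisms $\phi$ (an empty maximum is $0$). Set $d_{\mathrm{loc}}(\xi,\xi')=\sum_{r\ge0}2^{-r-1}d_r([\xi]_r,[\xi']_r)$, and let $\widetilde{\mathcal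 G}_*$ be the quotient of $\mathcal G_*$ by $\{d_{\mathrm{loc}}=0\}$, with metric $d_{\mathrm{loc}}$. **Recursion.** $W_{vu}=C_{vu}/\sum_{w:(v,w)\in E(G)}C_{vw}$ for an edge $(v,u)$, $0$ otherwise (vertices without outgoing edges have zero network input). For $\xi=[G,o,\mathcal M(G)]$: $x_v^0=0$ and $x_v^{k+1}=f_v\bigl(\sum_{u:(v,u)\in E(G)}W_{vu}x_u^k+\epsilon_v\bigr)$. The iterates $x^{\pm,k}$ follow the same recursion from the initializations given in the claim. The root values at step $k$ depend only on $[\xi]_k$. *)

(* Defs.v *)
From HB Require Import structures.
From mathcomp Require Import all_boot all_order all_algebra generic_quotient.
From mathcomp Require Import all_classical all_reals all_analysis.

Set Implicit Arguments.
Unset Strict Implicit.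
Unset Printing Implicit Defensive.

Import Order.TTheory GRing.Theory Num.Theory.
Import numFieldNormedType.Exports.

Local Open Scope classical_set_scope.
Local Open Scope ring_scope.
Local Open Scope quotient_scope.

Section real_lemmas.
Context {R : realType}.
Implicit Types (a b c : nat -> R) (S : set R) (x y z : R).

Lemma dyadic_sum_cvg m a : (forall q, 0 <= a q <= 2 ^- q) ->
  cvgn (fun n => \sum_(m <= q < n) a q).
Proof.
move=> ha; apply: nondecreasing_is_cvgn.
  apply/nondecreasing_seqP => n; have [mn|nm] := leqP m n.
    by rewrite big_nat_recr//= lerDl; case/andP: (ha n).
  by rewrite !big_geq// ltnW.
exists 2 => _ [n _ <-].
suff H : \sum_(m <= q < n) a q + 2 * 2 ^- n <= 2.
  by apply: le_trans H; rewrite lerDl mulr_ge0// invr_ge0 exprn_ge0.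
have e k : 2 * 2 ^- k.+1 = 2 ^- k :> R.
  by rewrite exprS invfM mulrA divff ?mul1r// pnatr_eq0.
elim: n => [|n IH]; first by rewrite big_geq// add0r expr0 invr1 mulr1.
have [mn|nm] := leqP m n.
  rewrite big_nat_recr//= e; apply: le_trans IH.
  rewrite -addrA lerD2l mulr_natl mulr2n lerD2r.
  by case/andP: (ha n).
rewrite big_geq// add0r e (le_trans (y := 1)) ?ler1n//.
by rewrite invf_le1 ?exprn_gt0// exprn_ege1// ler1n.
Qed.

Lemma dyadic_sum_le m a b c : (forall q, 0 <= a q <= 2 ^- q) ->
    (forall q, 0 <= b q <= 2 ^- q) -> (forall q, 0 <= c q <= 2 ^- q) ->
    (forall q, a q <= b q + c q) ->
  limn (fun n => \sum_(m <= q < n) a q) <=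
  limn (fun n => \sum_(m <= q < n) b q) + limn (fun n => \sum_(m <= q < n) c q).
Proof.
move=> ha hb hc habc.
rewrite -limD; [|exact: dyadic_sum_cvg..].
apply: ler_lim; [exact: dyadic_sum_cvg| |].
  by apply: is_cvgD; exact: dyadic_sum_cvg.
apply: nearW => n.
apply: (@le_trans _ _ (\sum_(m <= q < n) (b q + c q))); first exact: ler_sum.
by rewrite big_split.
Qed.

Lemma dyadic_sum_eq0 m a : (forall q, 0 <= a q <= 2 ^- q) ->
  limn (fun n => \sum_(m <= q < n) a q) = 0 -> forall q, (m <= q)%N -> a q = 0.
Proof.
move=> ha h0 q mq.
have nd : nondecreasing_seq (fun n => \sum_(m <= q < n) a q).
  apply/nondecreasing_seqP => n; have [mn|nm] := leqP m n.
    by rewrite big_nat_recr//= lerDl; case/andP: (ha n).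
  by rewrite !big_geq// ltnW.
have := nondecreasing_cvgn_le nd (dyadic_sum_cvg (m := m) ha) q.+1.
rewrite h0 big_nat_recr//= => H.
have [a0 _] := andP (ha q); apply/eqP; rewrite eq_le a0 andbT.
apply: le_trans H; rewrite lerDr sumr_ge0// => i _.
by case/andP: (ha i).
Qed.

Lemma sup_nonneg S : (forall x, S x -> 0 <= x) -> 0 <= sup S.
Proof.
move=> h; have [hs|/sup_out->//] := pselect (has_sup S).
have [[x Sx] ub] := hs; apply: le_trans (h _ Sx) _; exact: ub_le_sup.
Qed.

Lemma sup_le_bound S (b : R) : 0 <= b -> (forall x, S x -> x <= b) -> sup S <= b.
Proof.
move=> b0 h; have [S0|S0] := pselect (S !=set0); first exact: ge_sup.
by rewrite sup_out// => -[].
Qed.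

Lemma min1_ge0 x : 0 <= x -> 0 <= Num.min 1 x <= 1.
Proof. by move=> x0; rewrite le_min ler01 x0/= ge_min lexx. Qed.

Lemma min1_triangle x y z : 0 <= y -> 0 <= z -> x <= y + z ->
  Num.min 1 x <= Num.min 1 y + Num.min 1 z.
Proof.
move=> y0 z0 xyz.
have [y1|y1] := leP 1 y.
  by rewrite ge_min lerDl; case/andP: (min1_ge0 z0) => ->.
have [z1|z1] := leP 1 z; first by rewrite ge_min lerDr y0.
by rewrite ge_min xyz orbT.
Qed.

Lemma min1_eq0 x : Num.min 1 x = 0 -> x = 0.
Proof. by rewrite minElt; case: ifP => // _ /eqP; rewrite oner_eq0. Qed.

End real_lemmas.

(* Complete metrics inducing the given topology. On a product of topological
   spaces these are the complete product metrics. *)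
Record complete_metric (R : realType) (X : topologicalType) := CompleteMetric {
  cm_dist :> X -> X -> R ;
  cm_distxx : forall x, cm_dist x x = 0 ;
  cm_dist_positivity : forall x y, cm_dist x y = 0 -> x = y ;
  cm_dist_sym : forall x y, cm_dist x y = cm_dist y x ;
  cm_dist_triangle : forall y x z, cm_dist x z <= cm_dist x y + cm_dist y z ;
  cm_dist_nbhs : forall x (A : set X),
    nbhs x A <-> exists2 e, 0 < e & [set y | cm_dist x y < e] `<=` A ;
  cm_dist_complete : forall u : nat -> X,
    (forall e, 0 < e -> exists N, forall m n, (N <= m)%N -> (N <= n)%N ->
      cm_dist (u m) (u n) < e) ->
    exists l : X, u @ \oo --> l }.

Definition separable (T : topologicalType) : Prop :=
  exists2 D : set T, countable D & dense D.

Lemma cm_dist_ge0 (R : realType) (X : topologicalType)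
  (d : complete_metric R X) x y : 0 <= d x y.
Proof.
have := cm_dist_triangle d y x x.
by rewrite cm_distxx (cm_dist_sym d y x) -mulr2n pmulrn_lge0.
Qed.

Section response_functions.
Context {R : realType}.

(* This is the supremum of |f - g| over A only when f and g are bounded on A,
   as sup of an unbounded set is 0. *)
Definition sup_dist (A : set R) (f g : R -> R) : R :=
  sup [set `|f z - g z| | z in A].

Definition loc_bounded_by (A : set R) (f : R -> R) :=
  exists M, forall z, A z -> `|f z| <= M.

Lemma sup_dist_ub A f g z : loc_bounded_by A f -> loc_bounded_by A g ->
  A z -> `|f z - g z| <= sup_dist A f g.
Proof.
move=> [M fM] [N gN] Az; apply: ub_le_sup; last by exists z.
exists (M + N) => _ [y Ay <-].
by rewrite (le_trans (ler_normB _ _))// lerD ?fM ?gN.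
Qed.

Lemma sup_dist_ge0 A f g : 0 <= sup_dist A f g.
Proof. by apply: sup_nonneg => _ [y _ <-]. Qed.

Lemma sup_distxx A f : sup_dist A f f = 0.
Proof.
apply/eqP; rewrite eq_le sup_dist_ge0 andbT.
by apply: sup_le_bound => // _ [z _ <-]; rewrite subrr normr0.
Qed.

Lemma sup_dist_sym A f g : sup_dist A f g = sup_dist A g f.
Proof.
by congr sup; apply/seteqP; split=> _ [z Az <-]; exists z; rewrite // distrC.
Qed.

Lemma sup_dist_triangle A g f h : loc_bounded_by A f -> loc_bounded_by A g ->
  loc_bounded_by A h -> sup_dist A f h <= sup_dist A f g + sup_dist A g h.
Proof.
move=> bf bg bh; apply: sup_le_bound; first by rewrite addr_ge0 ?sup_dist_ge0.
by move=> _ [z Az <-]; rewrite (le_trans (ler_distD (g z) _ _))// lerD ?sup_dist_ub.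
Qed.

Record Fc (L : R) := MkFc {
  Fc_fun :> R -> R ;
  Fc_continuous : continuous Fc_fun ;
  Fc_nondecreasing : {homo Fc_fun : x y / x <= y} ;
  Fc_at0 : Fc_fun 0 = 0 ;
  Fc_lipschitz : L.-lipschitz Fc_fun }.

Record Fne := MkFne {
  Fne_fun :> R -> R ;
  Fne_bounded : bounded_fun Fne_fun ;
  Fne_ge0 : forall z, 0 <= Fne_fun z ;
  Fne_nondecreasing : {homo Fne_fun : x y / x <= y} ;
  Fne_lipschitz : 1.-lipschitz Fne_fun }.

HB.instance Definition _ L := gen_eqMixin (Fc L).
HB.instance Definition _ L := gen_choiceMixin (Fc L).
HB.instance Definition _ := gen_eqMixin Fne.
HB.instance Definition _ := gen_choiceMixin Fne.

Lemma Fc_ext L (f g : Fc L) : f =1 g -> f = g.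
Proof.
move=> /funext; case: f g => [f f1 f2 f3 f4] [g g1 g2 g3 g4] /= E.
by subst g; congr MkFc; exact: Prop_irrelevance.
Qed.

Lemma Fne_ext (f g : Fne) : f =1 g -> f = g.
Proof.
move=> /funext; case: f g => [f f1 f2 f3 f4] [g g1 g2 g3 g4] /= E.
by subst g; congr MkFne; exact: Prop_irrelevance.
Qed.

Definition Fc_dist L (f g : Fc L) : R :=
  limn (fun n => \sum_(1 <= q < n)
    2 ^- q * Num.min 1 (sup_dist [set z | `|z| <= q%:R] f g)).

Definition Fne_dist (f g : Fne) : R := sup_dist setT f g.

Definition Fne_sup (f : Fne) : R := sup (range f).

Section Fc_metric.
Variable L : R.
Implicit Types f g h : Fc L.

Lemma Fc_loc_bounded f (q : nat) :
  loc_bounded_by [set z | `|z| <= q%:R] f.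
Proof.
exists (Num.max `|f (- q%:R)| `|f q%:R|) => z /=; rewrite ler_norml => /andP[qz zq].
have h1 := Fc_nondecreasing f qz; have h2 := Fc_nondecreasing f zq.
rewrite le_max; have [z0|z0] := leP 0 (f z).
  by rewrite orbC (ger0_norm z0) (le_trans h2)// ler_norm.
by rewrite (ltr0_norm z0) (le_trans (y := - f (- q%:R))) ?lerN2// -normrN ler_norm.
Qed.

Let term_bnd f g q :
  0 <= 2 ^- q * Num.min 1 (sup_dist [set z | `|z| <= q%:R] f g) <= 2 ^- q.
Proof.
have /andP[m0 m1] := min1_ge0 (sup_dist_ge0 [set z | `|z| <= q%:R] f g).
have p0 : 0 <= 2 ^- q :> R by rewrite invr_ge0 exprn_ge0.
by rewrite mulr_ge0//= ler_piMr.
Qed.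

Lemma Fc_distxx f : Fc_dist f f = 0.
Proof.
rewrite /Fc_dist (_ : (fun _ => _) = cst 0); first exact: lim_cst.
apply/funext => n; rewrite big1// => q _.
by rewrite sup_distxx min_r ?mulr0.
Qed.

Lemma Fc_dist_sym f g : Fc_dist f g = Fc_dist g f.
Proof.
congr (limn _); apply/funext => n; apply: eq_bigr => q _.
by rewrite sup_dist_sym.
Qed.

Lemma Fc_dist_triangle g f h : Fc_dist f h <= Fc_dist f g + Fc_dist g h.
Proof.
apply: dyadic_sum_le => // q.
rewrite -mulrDr ler_wpM2l ?invr_ge0 ?exprn_ge0//.
by apply: min1_triangle; rewrite ?sup_dist_ge0//;
  apply: sup_dist_triangle; exact: Fc_loc_bounded.
Qed.

Lemma Fc_dist_positivity f g : Fc_dist f g = 0 -> f = g.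
Proof.
move=> /(dyadic_sum_eq0 (term_bnd f g)) H; apply: Fc_ext => z.
pose q := (Num.truncn `|z|).+1.
have zq : `|z| <= q%:R by rewrite ltW// truncnS_gt.
have /eqP := H q isT; rewrite mulf_eq0 invr_eq0 expf_eq0 pnatr_eq0 andbF/=.
move=> /eqP/min1_eq0 E.
have := @sup_dist_ub _ _ _ z (Fc_loc_bounded f q) (Fc_loc_bounded g q) zq.
by rewrite E normr_le0 subr_eq0 => /eqP.
Qed.

HB.instance Definition _ := isMetric.Build R (Fc L)
  Fc_distxx Fc_dist_positivity Fc_dist_sym Fc_dist_triangle.

End Fc_metric.

Section Fne_metric.
Implicit Types f g h : Fne.

Lemma Fne_loc_bounded f : loc_bounded_by setT f.
Proof.
have [M [_ fM]] := Fne_bounded f; exists (M + 1) => z _.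
by apply: (fM (M + 1)) => //; rewrite ltrDl.
Qed.

Lemma Fne_distxx f : Fne_dist f f = 0.
Proof. exact: sup_distxx. Qed.

Lemma Fne_dist_sym f g : Fne_dist f g = Fne_dist g f.
Proof. exact: sup_dist_sym. Qed.

Lemma Fne_dist_triangle g f h : Fne_dist f h <= Fne_dist f g + Fne_dist g h.
Proof. by apply: sup_dist_triangle; exact: Fne_loc_bounded. Qed.

Lemma Fne_dist_positivity f g : Fne_dist f g = 0 -> f = g.
Proof.
move=> E; apply: Fne_ext => z.
have := @sup_dist_ub _ _ _ z (Fne_loc_bounded f) (Fne_loc_bounded g) I.
by rewrite -/(Fne_dist f g) E normr_le0 subr_eq0 => /eqP.
Qed.

HB.instance Definition _ := isMetric.Build R Fne
  Fne_distxx Fne_dist_positivity Fne_dist_sym Fne_dist_triangle.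

End Fne_metric.

End response_functions.

Arguments Fne : clear implicits.
Arguments Fne_fun {R}.
Arguments Fne_sup {R}.

(* Only the values of emark on edges are meaningful: isomorphisms and distances
   ignore the others. The vertices form a bare Type because mgraph has to live
   in a universe small enough to be itself a choiceType (to form quotients). *)
Record mgraph (R : realType) (X : Type) := MGraph {
  vertex : Type ;
  edge : rel vertex ;
  edge_finite : forall v, finite_set [set u | edge v u] ;
  origin : vertex ;
  vmark : vertex -> X ;
  emark : vertex -> vertex -> {posnum R} }.

HB.instance Definition _ R X := gen_eqMixin (mgraph R X).
HB.instance Definition _ R X := gen_choiceMixin (mgraph R X).

HB.instance Definition _ R X (g : mgraph R X) := gen_eqMixin (vertex g).
HB.instance Definition _ R X (g : mgraph R X) := gen_choiceMixin (vertex g).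

Section graphs.
Context {R : realType} {X : Type}.
Implicit Types g h l : mgraph R X.

Definition digraph_iso g h (phi : vertex g -> vertex h) : Prop :=
  [/\ bijective phi, phi (origin g) = origin h &
      forall v u, edge (phi v) (phi u) = edge v u].

Definition marked_iso g h (phi : vertex g -> vertex h) : Prop :=
  [/\ digraph_iso phi, forall v, vmark (phi v) = vmark v &
      forall v u, edge v u -> emark (phi v) (phi u) = emark v u].

Definition isomorphic : rel (mgraph R X) :=
  fun g h => `[< exists phi : vertex g -> vertex h, marked_iso phi >].

Lemma digraph_iso_id g : digraph_iso (id : vertex g -> vertex g).
Proof. by split => //; exists id. Qed.

Lemma digraph_iso_comp g h l (phi : vertex g -> vertex h)
    (psi : vertex h -> vertex l) :
  digraph_iso phi -> digraph_iso psi -> digraph_iso (psi \o phi).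
Proof.
move=> [bphi ophi ephi] [bpsi opsi epsi]; split => /=.
- exact: bij_comp.
- by rewrite ophi.
- by move=> v u; rewrite epsi.
Qed.

Lemma digraph_iso_inv g h (phi : vertex g -> vertex h) : digraph_iso phi ->
  exists psi : vertex h -> vertex g,
    [/\ digraph_iso psi, cancel phi psi & cancel psi phi].
Proof.
move=> [[psi phiK psiK] ophi ephi]; exists psi; split => //; split.
- by exists phi.
- by rewrite -ophi phiK.
- by move=> v u; rewrite -ephi !psiK.
Qed.

Lemma marked_iso_inv g h (phi : vertex g -> vertex h) : marked_iso phi ->
  exists psi : vertex h -> vertex g,
    [/\ marked_iso psi, cancel phi psi & cancel psi phi].
Proof.
move=> [iphi mphi ephi]; have [psi [ipsi phiK psiK]] := digraph_iso_inv iphi.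
exists psi; split => //; split => // [v|v u vu].
  by rewrite -[in RHS](psiK v) mphi.
by rewrite -[in RHS](psiK v) -[in RHS](psiK u) ephi//; case: ipsi => _ _ ->.
Qed.

Lemma isomorphic_refl : reflexive isomorphic.
Proof. by move=> g; apply/asboolP; exists id; split => //; exact: digraph_iso_id. Qed.

Lemma isomorphic_sym : symmetric isomorphic.
Proof.
suff H g h : isomorphic g h -> isomorphic h g by move=> g h; apply/idP/idP; exact: H.
by move=> /asboolP[phi /marked_iso_inv[psi [ipsi _ _]]]; apply/asboolP; exists psi.
Qed.

Lemma isomorphic_trans : transitive isomorphic.
Proof.
move=> h g l /asboolP[phi [iphi mphi ephi]] /asboolP[psi [ipsi mpsi epsi]].
apply/asboolP; exists (psi \o phi); split => [|v|v u vu] /=.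
- exact: digraph_iso_comp.
- by rewrite mpsi.
- by rewrite epsi ?ephi//; case: iphi => _ _ ->.
Qed.

Canonical isomorphic_equiv :=
  EquivRel isomorphic isomorphic_refl isomorphic_sym isomorphic_trans.

(* The value is +oo%E when no directed path exists. *)
Definition hop_dist g (v : vertex g) : \bar R :=
  ereal_inf [set ((size p)%:R)%:E | p in
    [set p | path (@edge _ _ g) (origin g) p /\ last (origin g) p = v]].

Definition fball k g := {v : vertex g | (hop_dist v <= k%:R%:E)%E}.
Arguments fball : clear implicits.

Lemma origin_fball k g : (hop_dist (origin g) <= k%:R%:E)%E.
Proof.
rewrite (@le_trans _ _ 0%E)// ?lee_fin//.
by apply: ereal_inf_lbound; exists [::].
Qed.

Definition trunc_edge k g : rel (fball k g) :=
  fun v u => edge (sval v) (sval u) && (hop_dist (sval v) < k%:R%:E)%E.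
Arguments trunc_edge : clear implicits.

Lemma trunc_edge_finite k g v : finite_set [set u | trunc_edge k g v u].
Proof.
apply: (@sub_finite_set _ _ (@sval _ _ @^-1` [set u | edge (sval v) u])).
  by move=> u /andP[].
apply: finite_preimage (edge_finite (sval v)).
by move=> ? ? _ _ /val_inj.
Qed.

Definition trunc k g : mgraph R X := {|
  vertex := fball k g ;
  edge := trunc_edge k g ;
  edge_finite := @trunc_edge_finite k g ;
  origin := exist _ (origin g) (origin_fball k g) ;
  vmark := fun v => vmark (sval v) ;
  emark := fun v u => emark (sval v) (sval u) |}.

Lemma hop_dist_iso g h (phi : vertex g -> vertex h) v :
  digraph_iso phi -> hop_dist (phi v) = hop_dist v.
Proof.
have le a b (f : vertex a -> vertex b) w : digraph_iso f ->
    (hop_dist (f w) <= hop_dist w)%E.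
  move=> [_ of_ ef]; apply: le_ereal_inf_tmp => _ [p [ap <-] <-].
  apply: ereal_inf_lbound; exists (map f p); last by rewrite size_map.
  split; last by rewrite -of_ last_map.
  rewrite -of_ path_map; apply: sub_path ap => x y.
  by rewrite /= ef.
move=> iphi; apply/eqP; rewrite eq_le (le _ _ phi)//=.
have [psi [ipsi phiK _]] := digraph_iso_inv iphi.
by rewrite -[X in (hop_dist X <= _)%E]phiK (le _ _ psi).
Qed.

Lemma trunc_isomorphic k g h : isomorphic g h -> isomorphic (trunc k g) (trunc k h).
Proof.
move=> /asboolP[phi iphi]; have [psi [ipsi phiK psiK]] := marked_iso_inv iphi.
have fphi (v : fball k g) : (hop_dist (phi (sval v)) <= k%:R%:E)%E.
  case: v => v /= vk; rewrite (@hop_dist_iso _ _ phi)//.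
  by case: iphi.
have fpsi (v : fball k h) : (hop_dist (psi (sval v)) <= k%:R%:E)%E.
  case: v => v /= vk; rewrite (@hop_dist_iso _ _ psi)//.
  by case: ipsi.
apply/asboolP; exists (fun v => exist _ (phi (sval v)) (fphi v)).
case: iphi => iphi mphi ephi; split; first split.
- exists (fun v => exist _ (psi (sval v)) (fpsi v)) => v; apply: val_inj => /=.
    exact: phiK.
  exact: psiK.
- by apply: val_inj => /=; case: iphi.
- move=> v u; rewrite /= /trunc_edge/= hop_dist_iso//.
  by case: iphi => _ _ ->.
- by move=> v /=; rewrite mphi.
- by move=> v u /= /andP[vu _]; rewrite ephi.
Qed.

End graphs.

Definition Gstar (R : realType) (X : Type) : Type :=
  {eq_quot @isomorphic R X}.
HB.instance Definition _ R X := EqQuotient.on (Gstar R X).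
HB.instance Definition _ R X := Choice.on (Gstar R X).

Definition trunc_class (R : realType) (X : Type) k (xi : Gstar R X) : Gstar R X :=
  \pi_(Gstar R X) (trunc k (repr xi)).

Lemma trunc_classE (R : realType) (X : Type) k (g : mgraph R X) :
  trunc_class k (\pi_(Gstar R X) g) = \pi_(Gstar R X) (trunc k g).
Proof.
apply/eqmodP/trunc_isomorphic.
by have /eqmodP := reprK (\pi_(Gstar R X) g).
Qed.

Section local_metric.
Context {R : realType} {X : topologicalType} (d : complete_metric R X).
Implicit Types g h l : mgraph R X.

Definition dV (m m' : X) : R := Num.min 1 (d m m').

Definition dE (c c' : {posnum R}) : R :=
  Num.min 1 `|ln c%:num - ln c'%:num|.

Definition vertex_cost g h (phi : vertex g -> vertex h) : R :=
  sup [set dV (vmark v) (vmark (phi v)) | v in setT].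

Definition edge_cost g h (phi : vertex g -> vertex h) : R :=
  sup [set dE (emark e.1 e.2) (emark (phi e.1) (phi e.2)) |
       e in [set e : vertex g * vertex g | edge e.1 e.2]].

Definition cost g h (phi : vertex g -> vertex h) : R :=
  Num.max (vertex_cost phi) (edge_cost phi).

(* On truncations, which are finite graphs, the suprema and the infimum are
   attained; sup set0 = 0, so a graph without edges has edge_cost 0. *)
Definition mgraph_dist g h : R :=
  if `[< exists phi : vertex g -> vertex h, digraph_iso phi >] then
    inf [set cost phi | phi in @digraph_iso R X g h]
  else 1.

Let dV_bnd m m' : 0 <= dV m m' <= 1.
Proof. exact/min1_ge0/cm_dist_ge0. Qed.

Let dE_bnd c c' : 0 <= dE c c' <= 1.
Proof. exact/min1_ge0. Qed.

Let vcost_ub g h (phi : vertex g -> vertex h) v :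
  dV (vmark v) (vmark (phi v)) <= vertex_cost phi.
Proof.
apply: ub_le_sup; last by exists v.
by exists 1 => _ [u _ <-]; case/andP: (dV_bnd (vmark u) (vmark (phi u))).
Qed.

Let ecost_ub g h (phi : vertex g -> vertex h) v u : edge v u ->
  dE (emark v u) (emark (phi v) (phi u)) <= edge_cost phi.
Proof.
move=> vu; apply: ub_le_sup; last by exists (v, u).
exists 1 => _ [e _ <-].
by case/andP: (dE_bnd (emark e.1 e.2) (emark (phi e.1) (phi e.2))).
Qed.

Let vcost_ge0 g h (phi : vertex g -> vertex h) : 0 <= vertex_cost phi.
Proof.
by apply: sup_nonneg => _ [v _ <-]; case/andP: (dV_bnd (vmark v) (vmark (phi v))).
Qed.

Let ecost_ge0 g h (phi : vertex g -> vertex h) : 0 <= edge_cost phi.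
Proof.
apply: sup_nonneg => _ [e _ <-].
by case/andP: (dE_bnd (emark e.1 e.2) (emark (phi e.1) (phi e.2))).
Qed.

Lemma cost_ge0 g h (phi : vertex g -> vertex h) : 0 <= cost phi.
Proof. by rewrite le_max vcost_ge0. Qed.

Lemma cost_le g h (phi : vertex g -> vertex h) (b : R) : 0 <= b ->
  (forall v, dV (vmark v) (vmark (phi v)) <= b) ->
  (forall v u, edge v u -> dE (emark v u) (emark (phi v) (phi u)) <= b) ->
  cost phi <= b.
Proof.
move=> b0 hv he; rewrite ge_max; apply/andP; split; apply: sup_le_bound => //.
  by move=> _ [v _ <-].
by move=> _ [[v u] /= vu <-]; exact: he.
Qed.

Lemma cost_le1 g h (phi : vertex g -> vertex h) : cost phi <= 1.
Proof.
apply: cost_le => // [v|v u _].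
  by case/andP: (dV_bnd (vmark v) (vmark (phi v))).
by case/andP: (dE_bnd (emark v u) (emark (phi v) (phi u))).
Qed.

Lemma cost_comp g h l (phi : vertex g -> vertex h) (psi : vertex h -> vertex l) :
  digraph_iso phi -> cost (psi \o phi) <= cost phi + cost psi.
Proof.
move=> [_ _ ephi]; apply: cost_le; first by rewrite addr_ge0 ?cost_ge0.
- move=> v; apply: (@le_trans _ _ (vertex_cost phi + vertex_cost psi)); last first.
    by rewrite lerD// le_max lexx.
  apply: le_trans (lerD (vcost_ub phi v) (vcost_ub psi (phi v))).
  by apply: min1_triangle; rewrite ?cm_dist_ge0//; exact: cm_dist_triangle.
- move=> v u vu; apply: (@le_trans _ _ (edge_cost phi + edge_cost psi)); last first.
    by rewrite lerD// le_max lexx orbT.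
  have vu' : edge (phi v) (phi u) by rewrite ephi.
  apply: le_trans (lerD (ecost_ub phi vu) (ecost_ub psi vu')).
  by apply: min1_triangle => //; exact: ler_distD.
Qed.

Lemma cost_inv g h (phi : vertex g -> vertex h) (psi : vertex h -> vertex g) :
  digraph_iso phi -> cancel psi phi -> cost psi <= cost phi.
Proof.
move=> [_ _ ephi] psiK; apply: cost_le; first exact: cost_ge0.
- move=> v; have := vcost_ub phi (psi v); rewrite psiK {1}/dV cm_dist_sym.
  by move=> /le_trans; apply; rewrite le_max lexx.
- move=> v u vu; have vu' : edge (psi v) (psi u) by rewrite -ephi !psiK.
  have := ecost_ub phi vu'; rewrite !psiK {1}/dE distrC.
  by move=> /le_trans; apply; rewrite le_max lexx orbT.
Qed.

Lemma mgraph_dist_le g h (phi : vertex g -> vertex h) : digraph_iso phi ->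
  mgraph_dist g h <= cost phi.
Proof.
move=> iphi; rewrite /mgraph_dist ifT; last by apply/asboolP; exists phi.
apply: ge_inf; last by exists phi.
by exists 0 => _ [psi _ <-]; exact: cost_ge0.
Qed.

Lemma mgraph_dist_ge g h (b : R) : b <= 1 ->
  (forall phi : vertex g -> vertex h, digraph_iso phi -> b <= cost phi) ->
  b <= mgraph_dist g h.
Proof.
move=> b1 hb; rewrite /mgraph_dist; case: asboolP => // -[phi iphi].
apply: lb_le_inf; first by exists (cost phi), phi.
by move=> _ [psi ipsi <-]; exact: hb.
Qed.

Lemma mgraph_dist_bnd g h : 0 <= mgraph_dist g h <= 1.
Proof.
apply/andP; split; first by apply: mgraph_dist_ge => // phi _; exact: cost_ge0.
have [[phi iphi]|nphi] := pselect (exists phi : vertex g -> vertex h, digraph_iso phi).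
  exact: le_trans (mgraph_dist_le iphi) (cost_le1 phi).
by rewrite /mgraph_dist; case: asboolP.
Qed.

Lemma mgraph_dist_sym g h : mgraph_dist g h = mgraph_dist h g.
Proof.
suff H a b : mgraph_dist a b <= mgraph_dist b a by apply/eqP; rewrite eq_le !H.
apply: mgraph_dist_ge; first by case/andP: (mgraph_dist_bnd a b).
move=> phi iphi; have [psi [ipsi _ psiK]] := digraph_iso_inv iphi.
apply: le_trans (mgraph_dist_le ipsi) _; apply: cost_inv => //.
Qed.

Lemma mgraph_dist_triangle h g l :
  mgraph_dist g l <= mgraph_dist g h + mgraph_dist h l.
Proof.
have /andP[_ gl1] := mgraph_dist_bnd g l.
have /andP[gh0 _] := mgraph_dist_bnd g h.
have /andP[hl0 _] := mgraph_dist_bnd h l.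
rewrite -lerBlDr; apply: mgraph_dist_ge.
  by rewrite lerBlDr (le_trans gl1)// lerDl.
move=> phi iphi; rewrite lerBlDr addrC -lerBlDr; apply: mgraph_dist_ge.
  by rewrite lerBlDr (le_trans gl1)// lerDl cost_ge0.
move=> psi ipsi; rewrite lerBlDr addrC.
exact: le_trans (mgraph_dist_le (digraph_iso_comp iphi ipsi)) (cost_comp _ iphi).
Qed.

Lemma mgraph_dist_iso g h : isomorphic g h -> mgraph_dist g h = 0.
Proof.
move=> /asboolP[phi [iphi mphi ephi]]; apply/eqP; rewrite eq_le.
case/andP: (mgraph_dist_bnd g h) => -> _; rewrite andbT.
apply: le_trans (mgraph_dist_le iphi) _; apply: cost_le => // [v|v u vu].
  by rewrite mphi /dV cm_distxx min_r.
by rewrite ephi// /dE subrr normr0 min_r.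
Qed.

Definition class_dist (a b : Gstar R X) : R := mgraph_dist (repr a) (repr b).

Lemma class_distE g h :
  class_dist (\pi_(Gstar R X) g) (\pi_(Gstar R X) h) = mgraph_dist g h.
Proof.
have iso k : isomorphic (repr (\pi_(Gstar R X) k)) k.
  by have /eqmodP := reprK (\pi_(Gstar R X) k).
have le a b a' b' : isomorphic a a' -> isomorphic b b' ->
    mgraph_dist a b <= mgraph_dist a' b'.
  move=> aa bb; apply: le_trans (mgraph_dist_triangle a' _ _) _.
  rewrite (mgraph_dist_iso aa) add0r.
  apply: le_trans (mgraph_dist_triangle b' _ _) _.
  by rewrite (mgraph_dist_sym b' b) (mgraph_dist_iso bb) addr0.
by apply/eqP; rewrite eq_le !le// isomorphic_sym.
Qed.

Definition dloc (xi xi' : Gstar R X) : R :=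
  limn (fun n => \sum_(0 <= r < n)
    2 ^- r.+1 * class_dist (trunc_class r xi) (trunc_class r xi')).

Let term_bnd xi xi' r :
  0 <= 2 ^- r.+1 * class_dist (trunc_class r xi) (trunc_class r xi') <= 2 ^- r.
Proof.
have /andP[m0 m1] :=
  mgraph_dist_bnd (repr (trunc_class r xi)) (repr (trunc_class r xi')).
have p0 n : 0 <= 2 ^- n :> R by rewrite invr_ge0 exprn_ge0.
rewrite mulr_ge0//= (le_trans (ler_piMr _ m1))//.
by rewrite exprS invfM ler_piMl// invf_le1 ?ler1n.
Qed.

Lemma dlocxx xi : dloc xi xi = 0.
Proof.
rewrite /dloc (_ : (fun _ => _) = cst 0); first exact: lim_cst.
apply/funext => n; rewrite big1// => q _.
by rewrite /class_dist mgraph_dist_iso ?mulr0// isomorphic_refl.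
Qed.

Lemma dloc_sym xi xi' : dloc xi xi' = dloc xi' xi.
Proof.
congr (limn _); apply/funext => n; apply: eq_bigr => q _.
by rewrite /class_dist mgraph_dist_sym.
Qed.

Lemma dloc_triangle eta xi zeta : dloc xi zeta <= dloc xi eta + dloc eta zeta.
Proof.
apply: dyadic_sum_le => // r.
rewrite -mulrDr ler_wpM2l ?invr_ge0 ?exprn_ge0//.
exact: mgraph_dist_triangle.
Qed.

Lemma dloc_ge0 xi eta : 0 <= dloc xi eta.
Proof.
have := dloc_triangle eta xi xi.
by rewrite dlocxx (dloc_sym eta xi) -mulr2n pmulrn_lge0.
Qed.

Definition dloc_zero : rel (Gstar R X) := fun xi xi' => dloc xi xi' == 0.

Lemma dloc_zero_refl : reflexive dloc_zero.
Proof. by move=> xi; rewrite /dloc_zero dlocxx. Qed.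

Lemma dloc_zero_sym : symmetric dloc_zero.
Proof. by move=> xi eta; rewrite /dloc_zero dloc_sym. Qed.

Lemma dloc_zero_trans : transitive dloc_zero.
Proof.
move=> eta xi zeta /eqP h1 /eqP h2; rewrite /dloc_zero eq_le dloc_ge0 andbT.
by rewrite (le_trans (dloc_triangle eta _ _))// h1 h2 addr0.
Qed.

Canonical dloc_zero_equiv :=
  EquivRel dloc_zero dloc_zero_refl dloc_zero_sym dloc_zero_trans.

Definition Gtilde : Type := {eq_quot dloc_zero}.
HB.instance Definition _ := EqQuotient.on Gtilde.
HB.instance Definition _ := Choice.on Gtilde.

Definition Gtilde_dist (x y : Gtilde) : R := dloc (repr x) (repr y).

Lemma Gtilde_distE xi eta :
  Gtilde_dist (\pi_Gtilde xi) (\pi_Gtilde eta) = dloc xi eta.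
Proof.
have z k : dloc (repr (\pi_Gtilde k)) k = 0.
  by have /eqmodP/eqP := reprK (\pi_Gtilde k).
have z' k : dloc k (repr (\pi_Gtilde k)) = 0 by rewrite dloc_sym z.
apply/eqP; rewrite eq_le /Gtilde_dist; apply/andP; split.
- apply: le_trans (dloc_triangle xi _ _) _; rewrite z add0r.
  by apply: le_trans (dloc_triangle eta _ _) _; rewrite z' addr0.
- apply: le_trans (dloc_triangle (repr (\pi_Gtilde xi)) _ _) _; rewrite z' add0r.
  by apply: le_trans (dloc_triangle (repr (\pi_Gtilde eta)) _ _) _; rewrite z addr0.
Qed.

Lemma Gtilde_distxx x : Gtilde_dist x x = 0.
Proof. exact: dlocxx. Qed.

Lemma Gtilde_dist_positivity x y : Gtilde_dist x y = 0 -> x = y.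
Proof.
move=> h; rewrite -(reprK x) -(reprK y); apply/eqmodP.
by rewrite /= /dloc_zero; apply/eqP.
Qed.

Lemma Gtilde_dist_sym x y : Gtilde_dist x y = Gtilde_dist y x.
Proof. exact: dloc_sym. Qed.

Lemma Gtilde_dist_triangle y x z :
  Gtilde_dist x z <= Gtilde_dist x y + Gtilde_dist y z.
Proof. exact: dloc_triangle. Qed.

HB.instance Definition _ := isMetric.Build R Gtilde
  Gtilde_distxx Gtilde_dist_positivity Gtilde_dist_sym Gtilde_dist_triangle.

Definition net_class g : Gtilde := \pi_Gtilde (\pi_(Gstar R X) g).

End local_metric.

(* F is the response-function space, whose elements are applied through resp;
   init gives the initial value at a vertex from its response function. *)
Section recursion.
Context {R : realType} {T F : Type} (resp : F -> R -> R).
Variables (init : F -> R) (g : mgraph R (T * R * F)).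

Definition weight (v u : vertex g) : R :=
  if edge v u then
    (emark v u)%:num / \sum_(w \in [set w | edge v w]) (emark v w)%:num
  else 0.

Fixpoint state (k : nat) (v : vertex g) : R :=
  if k is k'.+1 then
    resp (vmark v).2
      ((\sum_(u \in [set u | edge v u]) (weight v u * state k' u))
         + (vmark v).1.2)
  else init (vmark v).2.

End recursion.

(* Main.v *)
Require Import Defs.
From HB Require Import structures.
From mathcomp Require Import all_boot all_order all_algebra generic_quotient.
From mathcomp Require Import all_classical all_reals all_analysis.

Set Implicit Arguments.
Unset Strict Implicit.
Unset Printing Implicit Defensive.

Import Order.TTheory GRing.Theory Num.Theory.
Import numFieldNormedType.Exports.

Local Open Scope classical_set_scope.
Local Open Scope ring_scope.
Local Open Scope quotient_scope.

(** The local distance of two networks bounds, up to the factor [2 ^+ k.+1], the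
    distance of their radius-[k] truncations. When the latter is small (and less
    than 1) there is an isomorphism of the underlying digraphs along which
    all marks are close. So continuity of the root value reduces to this: if
    [phi] runs through digraph isomorphisms out of a fixed graph [g] and its
    cost tends to 0, then the state at [phi v] tends to the state at [v]
    ([state_cvg]).

    Such isomorphisms form the filter [iso_near d g]. Along it the vertex marks
    converge because [d] induces the product topology, and the edge marks
    converge because their logarithms do ([vmark_cvg], [emark_cvg]). The claim
    follows by induction on the step: an isomorphism matches the
    out-neighbours of [v] with those of [phi v], so the network input at [phi v]
    is a quotient of sums over one fixed finite set, whose terms all converge;
    its denominator has a positive limit as soon as [v] has an out-edge.

    Two facts complete the argument. The state at the root after [k] steps can be
    computed in the radius-[k] truncation ([state_trunc]). And the response
    [f z] is jointly continuous in [f] and [z], because evaluation at a fixed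
    [z] is continuous in [f] and all responses share a Lipschitz constant
    ([equilipschitz_joint_continuous]). Networks at distance 0 get the same
    root value by the very same estimate, so the functional descends to the
    quotient space ([root_functional]). *)

(** * Preliminaries on series, metrics and finite sums *)

Lemma min1_lt (R : realType) (x e : R) : e <= 1 -> Num.min 1 x < e -> x < e.
Proof. by move=> e1; rewrite gt_min ltNge e1. Qed.

Lemma dyadic_sum_ge_term (R : realType) (m : nat) (a : nat -> R) (q : nat) :
    (forall r, 0 <= a r <= 2 ^- r) -> (m <= q)%N ->
  a q <= limn (fun n => \sum_(m <= r < n) a r).
Proof.
move=> a0 mq.
have nd : nondecreasing_seq (fun n => \sum_(m <= r < n) a r).
  apply/nondecreasing_seqP => n; have [mn|nm] := leqP m n.
    by rewrite big_nat_recr//= lerDl; case/andP: (a0 n).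
  by rewrite !big_geq// ltnW.
apply: le_trans (nondecreasing_cvgn_le nd (dyadic_sum_cvg a0) q.+1).
by rewrite big_nat_recr//= lerDr sumr_ge0// => r _; case/andP: (a0 r).
Qed.

Lemma nbhs_mdist (R : realType) (M : metricType R) (x : M) (e : R) :
  0 < e -> \forall y \near x, mdist x y < e.
Proof. by move=> e0; have := nbhsx_ballx x e e0; rewrite ballEmdist. Qed.

Lemma cvg_fsum (R : realType) (S : Type) (Fi : set_system S) (FF : Filter Fi)
    (I : choiceType) (D : set I) (f : I -> S -> R) (a : I -> R) :
    finite_set D -> (forall i, D i -> f i s @[s --> Fi] --> a i) ->
  \sum_(i \in D) f i s @[s --> Fi] --> \sum_(i \in D) a i.
Proof.
move=> finD fa; rewrite fsbig_finite//= big_seq.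
under eq_fun do rewrite fsbig_finite//= big_seq.
apply: (cvg_big add_continuous) => i.
by rewrite in_fset_set// inE; exact: fa.
Qed.

(** * Isomorphisms of small cost *)

(** The codomain varies with the map, so that a filter on this type can describe
    a graph approaching [g] together with its matching with [g]. *)
Definition graph_map (R : realType) (X : Type) (g : mgraph R X) : Type :=
  {h : mgraph R X & vertex g -> vertex h}.

Definition gmap (R : realType) (X : Type) (g : mgraph R X) (p : graph_map g) :
  vertex g -> vertex (projT1 p) := projT2 p.

Definition iso_near (R : realType) (X : topologicalType)
    (d : complete_metric R X) (g : mgraph R X) :
    set_system (graph_map g) :=
  filter_from [set e | 0 < e] (fun e =>
    [set p | digraph_iso (gmap p) /\ cost d (gmap p) < e]).
Arguments iso_near {R X} d g.

Instance iso_near_filter (R : realType) (X : topologicalType)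
  (d : complete_metric R X) (g : mgraph R X) : Filter (iso_near d g).
Proof.
apply: filter_from_filter; first by exists 1 => /=.
move=> e1 e2 /= e10 e20; exists (Num.min e1 e2); first by rewrite /= lt_min e10.
by move=> p [ip]; rewrite lt_min => /andP[].
Qed.

Lemma cost_ge_dV (R : realType) (X : topologicalType)
    (d : complete_metric R X) (g h : mgraph R X) (phi : vertex g -> vertex h)
    (v : vertex g) :
  dV d (vmark v) (vmark (phi v)) <= cost d phi.
Proof.
rewrite le_max; apply/orP; left; apply: ub_le_sup; last by exists v.
by exists 1 => _ [u _ <-]; rewrite ge_min lexx.
Qed.

Lemma cost_ge_dE (R : realType) (X : topologicalType)
    (d : complete_metric R X) (g h : mgraph R X) (phi : vertex g -> vertex h)
    (v u : vertex g) : edge v u ->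
  dE (emark v u) (emark (phi v) (phi u)) <= cost d phi.
Proof.
move=> vu; rewrite le_max; apply/orP; right; apply: ub_le_sup.
  by exists 1 => _ [e _ <-]; rewrite ge_min lexx.
by exists (v, u).
Qed.

Lemma iso_near_iso (R : realType) (X : topologicalType)
    (d : complete_metric R X) (g : mgraph R X) :
  \forall p \near iso_near d g, digraph_iso (gmap p).
Proof. by exists 1 => [|p []] /=. Qed.

Lemma iso_near_cost (R : realType) (X : topologicalType)
    (d : complete_metric R X) (g : mgraph R X) (e : R) : 0 < e ->
  \forall p \near iso_near d g, cost d (gmap p) < e.
Proof. by move=> e0; exists e => [|p [_ ?]]. Qed.

(** A cost less than 1 bounds [d] itself and not only its minimum with 1, and [d]
    induces the given topology, so a vanishing cost gives convergence in the
    space of marks. *)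
Lemma vmark_cvg (R : realType) (X : topologicalType)
    (d : complete_metric R X) (g : mgraph R X) (v : vertex g) :
  vmark (gmap p v) @[p --> iso_near d g] --> vmark v.
Proof.
move=> A /(cm_dist_nbhs d)[e e0 eA].
have m0 : 0 < Num.min 1 e by rewrite lt_min ltr01.
apply: filterS (iso_near_cost d g m0) => p cp; apply: eA.
have : d (vmark v) (vmark (gmap p v)) < Num.min 1 e.
  apply: min1_lt; first by rewrite ge_min lexx.
  exact: le_lt_trans (cost_ge_dV d (gmap p) v) cp.
by rewrite lt_min => /andP[].
Qed.
Arguments vmark_cvg {R X} d {g} v.

(** The cost controls the logarithms of the edge marks; the exponential carries
    their convergence over to the marks. *)
Lemma emark_cvg (R : realType) (X : topologicalType)
    (d : complete_metric R X) (g : mgraph R X) (v u : vertex g) : edge v u ->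
  (emark (gmap p v) (gmap p u))%:num @[p --> iso_near d g] -->
  (emark v u)%:num.
Proof.
move=> vu.
suff H : ln (emark (gmap p v) (gmap p u))%:num @[p --> iso_near d g] -->
    ln (emark v u)%:num.
  have E : (fun p : graph_map g => (emark (gmap p v) (gmap p u))%:num) =
      expR \o (fun p => ln (emark (gmap p v) (gmap p u))%:num).
    by apply/funext => p /=; rewrite lnK ?posrE.
  rewrite E -[X in _ --> X]lnK ?posrE//.
  by apply: continuous_cvg H; exact: continuous_expR.
apply/cvgrPdist_lt => e e0.
have m0 : 0 < Num.min 1 e by rewrite lt_min ltr01.
apply: filterS (iso_near_cost d g m0) => p cp.
have : `|ln (emark v u)%:num - ln (emark (gmap p v) (gmap p u))%:num|
    < Num.min 1 e.
  apply: min1_lt; first by rewrite ge_min lexx.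
  exact: le_lt_trans (cost_ge_dE d (gmap p) vu) cp.
by rewrite lt_min => /andP[].
Qed.

(** * The recursion *)

(** With the common denominator factored out, the input is expressed by the
    edge marks alone, and the same formula gives 0 when there is no out-edge. *)
Lemma network_inputE (R : realType) (T F : Type) (g : mgraph R (T * R * F))
    (v : vertex g) (x : vertex g -> R) :
  \sum_(u \in [set u | edge v u]) (weight v u * x u) =
  (\sum_(u \in [set u | edge v u]) ((emark v u)%:num * x u)) /
  \sum_(u \in [set u | edge v u]) (emark v u)%:num.
Proof.
rewrite mulr_fsuml.
apply: eq_fsbigr => u; rewrite inE /= /weight => ->.
by rewrite mulrAC.
Qed.

(** Only the out-neighbourhood of [v] has to be preserved by [f]: this covers
    both digraph isomorphisms and, away from the boundary, the inclusion of a
    truncation into its graph. *)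
Lemma stateS_reindex (R : realType) (T F : Type) (resp : F -> R -> R)
    (init : F -> R) (g h : mgraph R (T * R * F)) (f : vertex g -> vertex h)
    (v : vertex g) (k : nat) :
    set_bij [set u | edge v u] [set u | edge (f v) u] f ->
  state resp init k.+1 (f v) =
  resp (vmark (f v)).2
    ((\sum_(u \in [set u | edge v u])
        ((emark (f v) (f u))%:num * state resp init k (f u))) /
     (\sum_(u \in [set u | edge v u]) (emark (f v) (f u))%:num)
     + (vmark (f v)).1.2).
Proof. by move=> fbij; rewrite /= network_inputE !(reindex_fsbig f _ _ _ fbij). Qed.

Lemma digraph_iso_out (R : realType) (X : Type) (g h : mgraph R X)
    (phi : vertex g -> vertex h) (v : vertex g) : digraph_iso phi ->
  set_bij [set u | edge v u] [set u | edge (phi v) u] phi.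
Proof.
move=> [bphi _ ephi]; split.
- by move=> u /= vu; rewrite ephi.
- by move=> a b _ _; exact: (bij_inj bphi).
- have [psi phiK psiK] := bphi; move=> u /= vu; exists (psi u) => //=.
  by rewrite -ephi psiK.
Qed.

Lemma hop_dist_edge (R : realType) (X : Type) (g : mgraph R X) (n : nat)
    (v u : vertex g) :
  (hop_dist v <= n%:R%:E)%E -> edge v u -> (hop_dist u <= n.+1%:R%:E)%E.
Proof.
move=> vn vu; suff H : (hop_dist u - 1 <= hop_dist v)%E.
  by rewrite -natr1 EFinD -leeBlDr// (le_trans H).
apply: le_ereal_inf_tmp => _ [p [op pv] <-].
rewrite leeBlDr// -EFinD natr1.
apply: ereal_inf_lbound; exists (rcons p u); last by rewrite size_rcons.
by split; [rewrite rcons_path op pv|rewrite last_rcons].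
Qed.

(** Each step of the recursion looks one edge further, so [j] steps from a vertex
    within distance [k - j] of the root stay inside the truncation, and never
    use the missing out-edges of its boundary vertices. *)
Lemma state_trunc (R : realType) (T F : Type) (resp : F -> R -> R)
    (init : F -> R) (g : mgraph R (T * R * F)) (k j : nat)
    (v : vertex (trunc k g)) :
    (j <= k)%N -> (hop_dist (sval v) <= (k - j)%:R%:E)%E ->
  state resp init j v = state resp init j (sval v).
Proof.
elim: j v => [//|j IH] v jk vk.
have vlt : (hop_dist (sval v) < k%:R%:E)%E.
  by apply: le_lt_trans vk _; rewrite lte_fin ltr_nat ltn_subrL (leq_trans _ jk).
have next u : edge (sval v) u -> (hop_dist u <= (k - j)%:R%:E)%E.
  by move=> vu; have := hop_dist_edge vk vu; rewrite -subSn// subSS.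
have fbij : set_bij [set u | edge v u] [set u | edge (sval v) u]
    (sval : vertex (trunc k g) -> vertex g).
  split.
  - by move=> u /andP[].
  - by move=> a b _ _ /val_inj.
  - move=> u /= vu.
    have uk : (hop_dist u <= k%:R%:E)%E.
      by apply: le_trans (next _ vu) _; rewrite lee_fin ler_nat leq_subr.
    by exists (exist _ u uk) => //=; rewrite /trunc_edge/= vu vlt.
rewrite (stateS_reindex resp init j fbij).
rewrite (stateS_reindex resp init j (digraph_iso_out v (digraph_iso_id _))).
congr (resp _ (_ / _ + _)); apply: eq_fsbigr => u; rewrite inE /= => /andP[vu _].
by rewrite IH//; [exact: ltnW|exact: next].
Qed.

(** Induction on [k]: once the sum over the out-neighbours of the image of [v] is
    pulled back to the fixed out-neighbours of [v], every ingredient of the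
    recursion converges. *)
Lemma state_cvg (R : realType) (T F : topologicalType) (resp : F -> R -> R)
    (init : F -> R) (d : complete_metric R (T * R * F)%type)
    (g : mgraph R (T * R * F)) (k : nat) (v : vertex g) :
    continuous (fun z : F * R => resp z.1 z.2) -> continuous init ->
  state resp init k (gmap p v) @[p --> iso_near d g] -->
  state resp init k v.
Proof.
move=> cresp cinit.
have cmark u : (vmark (gmap p u)).2 @[p --> iso_near d g] --> (vmark u).2.
  by apply: cvg_comp (vmark_cvg d u) _; exact: cvg_snd.
have cshock u :
    (vmark (gmap p u)).1.2 @[p --> iso_near d g] --> (vmark u).1.2.
  apply: (@cvg_comp _ _ _ _ (snd \o fst) _ _ _ (vmark_cvg d u)).
  by apply: cvg_comp; [exact: cvg_fst|exact: cvg_snd].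
elim: k v => [|k IH] v; first by apply: continuous_cvg (cmark v); exact: cinit.
rewrite (stateS_reindex resp init k (digraph_iso_out v (digraph_iso_id g))).
have eq_near : \forall p \near iso_near d g,
    resp (vmark (gmap p v)).2
      ((\sum_(u \in [set u | edge v u])
          ((emark (gmap p v) (gmap p u))%:num
            * state resp init k (gmap p u))) /
       (\sum_(u \in [set u | edge v u]) (emark (gmap p v) (gmap p u))%:num)
       + (vmark (gmap p v)).1.2) = state resp init k.+1 (gmap p v).
  apply: filterS (iso_near_iso d g) => p ip.
  by rewrite -(stateS_reindex _ _ _ (digraph_iso_out v ip)).
apply: cvg_trans (near_eq_cvg eq_near) _.
apply: (continuous2_cvg _ (cresp (_, _)) (cmark v)).
apply: cvgD (cshock v).
(* Without out-edges both sums vanish and the quotient is not continuous at 0 / 0,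
   but it is constantly 0 along the filter. *)
have [vu|novu] := pselect (exists u, edge v u); last first.
  rewrite (_ : [set u | edge v u] = set0); last first.
    by apply/seteqP; split => // u vu; apply: novu; exists u.
  under eq_fun do rewrite !fsbig_set0 mul0r.
  by rewrite fsbig_set0 mul0r; exact: cvg_cst.
have [w vw] := vu.
apply: cvgM; last apply: cvgV.
- apply: cvg_fsum => [|u vu']; first exact: edge_finite.
  by apply: cvgM (IH u); exact: emark_cvg.
- rewrite (fsbigD1 w)//=; last exact: edge_finite.
  by rewrite gt_eqF// ltr_pwDl// fsumr_ge0.
- by apply: cvg_fsum => [|u vu']; [exact: edge_finite|exact: emark_cvg].
Qed.

(** * Root functionals on the quotient space *)

(** A distance less than 1 excludes the default value 1 given to graphs that are
    not isomorphic, so it comes from an actual isomorphism. *)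
Lemma mgraph_dist_iso_lt (R : realType) (X : topologicalType)
    (d : complete_metric R X) (g h : mgraph R X) (e : R) :
    e <= 1 -> mgraph_dist d g h < e ->
  exists2 phi : vertex g -> vertex h, digraph_iso phi & cost d phi < e.
Proof.
move=> e1 ghe; apply: contrapT => nphi; move: ghe; apply/negP.
rewrite -leNgt; apply: mgraph_dist_ge => // phi iphi.
by rewrite leNgt; apply/negP => phie; apply: nphi; exists phi.
Qed.

Lemma dloc_ge_trunc (R : realType) (X : topologicalType)
    (d : complete_metric R X) (g h : mgraph R X) (k : nat) :
  2 ^- k.+1 * mgraph_dist d (trunc k g) (trunc k h) <=
  Gtilde_dist (net_class d g) (net_class d h).
Proof.
rewrite Gtilde_distE -class_distE -!trunc_classE.
set gg := \pi_(Gstar R X) g; set hh := \pi_(Gstar R X) h.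
pose a r : R := 2 ^- r.+1 * class_dist d (trunc_class r gg) (trunc_class r hh).
have p0 n : 0 <= 2 ^- n :> R by rewrite invr_ge0 exprn_ge0.
have a0 r : 0 <= a r <= 2 ^- r.
  have /andP[m0 m1] :=
    mgraph_dist_bnd d (repr (trunc_class r gg)) (repr (trunc_class r hh)).
  rewrite mulr_ge0//= (le_trans (ler_piMr _ m1))//.
  by rewrite exprS invfM ler_piMl// invf_le1 ?ler1n.
exact: (dyadic_sum_ge_term a0 (leq0n k)).
Qed.

(** The form of continuity at the class of [g] that serves both for the
    continuity of the functional and for its being well defined: networks at
    distance 0 have root values closer than every [e]. *)
Lemma root_state_near (R : realType) (T F : topologicalType)
    (resp : F -> R -> R) (init : F -> R)
    (d : complete_metric R (T * R * F)%type)
    (g : mgraph R (T * R * F)) (k : nat) (e : R) :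
    continuous (fun z : F * R => resp z.1 z.2) -> continuous init -> 0 < e ->
  exists2 del : R, 0 < del & forall h : mgraph R (T * R * F),
    Gtilde_dist (net_class d g) (net_class d h) < del ->
    `|state resp init k (origin g) - state resp init k (origin h)| < e.
Proof.
move=> cresp cinit e0.
have origin_trunc (h : mgraph R (T * R * F)) :
    state resp init k (origin (trunc k h)) = state resp init k (origin h).
  by apply: state_trunc => //=; rewrite subnn origin_fball.
have /cvgrPdist_lt/(_ _ e0)[del del0 H] :=
  state_cvg d (k := k) (v := origin (trunc k g)) cresp cinit.
have p0 : 0 < 2 ^- k.+1 :> R by rewrite invr_gt0 exprn_gt0.
have m0 : 0 < Num.min 1 del by rewrite lt_min ltr01.
exists (2 ^- k.+1 * Num.min 1 del) => [|h gh]; first exact: mulr_gt0.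
have /mgraph_dist_iso_lt[|phi iphi] :
    mgraph_dist d (trunc k g) (trunc k h) < Num.min 1 del.
- by rewrite -(ltr_pM2l p0) (le_lt_trans (dloc_ge_trunc d g h k)).
- by rewrite ge_min lexx.
rewrite lt_min => /andP[_ cphi].
have [_ ophi _] := iphi.
have /= := H (existT _ (trunc k h) phi) (conj iphi cphi).
by rewrite ophi !origin_trunc.
Qed.

Lemma root_functional (R : realType) (T F : topologicalType)
    (resp : F -> R -> R) (init : F -> R)
    (d : complete_metric R (T * R * F)%type) (k : nat) :
    continuous (fun z : F * R => resp z.1 z.2) -> continuous init ->
  exists Phi : Gtilde d -> R,
    (forall g : mgraph R (T * R * F),
      Phi (net_class d g) = state resp init k (origin g)) /\
    continuous Phi.
Proof.
move=> cresp cinit.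
pose rep (x : Gtilde d) : mgraph R (T * R * F) := repr (repr x).
have repK x : net_class d (rep x) = x by rewrite /net_class /rep !reprK.
exists (fun x => state resp init k (origin (rep x))); split.
- move=> g; apply/eqP; rewrite -subr_eq0 -normr_le0; apply/ler_addgt0Pl => e e0.
  have [del del0 H] := root_state_near d g k cresp cinit e0.
  by rewrite addr0 ltW// distrC H// repK Gtilde_distxx.
- move=> x; apply/(@cvgrPdist_lt _ _ _ _ (nbhs_filter x)) => e e0.
  have [del del0 H] := root_state_near d (rep x) k cresp cinit e0.
  apply: filterS (nbhs_mdist x del0) => y xy.
  by apply: H; rewrite !repK.
Qed.

(** * Response functions *)

(** Compare [f' z'] with [f z] through [f' z]: the first difference is at most
    [L * `|z' - z|] whatever [f'] is, the second is the convergence of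
    evaluations at [z]. *)
Lemma equilipschitz_joint_continuous (R : realType) (F : topologicalType)
    (resp : F -> R -> R) (L : R) :
    (forall f, L.-lipschitz (resp f)) ->
    (forall z, continuous (resp^~ z)) ->
  continuous (fun z : F * R => resp z.1 z.2).
Proof.
move=> lresp cresp [f z].
pose b (p : F * R) := L * `|p.2 - z| + `|resp p.1 z - resp f z|.
have b0 : b p @[p --> (f, z)] --> (0 : R).
  rewrite -[0](addr0 0); apply: cvgD.
    rewrite -[in X in _ --> X](mulr0 L); apply: cvgMl_tmp.
    rewrite -(normr0 R) -(subrr z); apply: cvg_norm.
    by apply: cvgB; [exact: cvg_snd|exact: cvg_cst].
  rewrite -(normr0 R) -(subrr (resp f z)); apply: cvg_norm.
  apply: cvgB; last exact: cvg_cst.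
  exact: (@continuous_cvg _ _ _ _ _ fst (resp^~ z) f (cresp z f) cvg_fst).
apply/cvgrPdist_lt => e e0.
have /cvgrPdist_lt/(_ _ e0) := b0; apply: filterS => p /=.
rewrite sub0r normrN => /(le_lt_trans (ler_norm _)); apply: le_lt_trans.
rewrite distrC (le_trans (ler_distD (resp p.1 z) _ _))// lerD2r.
exact: (lresp p.1 (p.2, z)).
Qed.

(** A ball of radius [2 ^- q] times a small number bounds the [q]-th term of the
    series, hence the distance uniformly on the interval of radius [q] around
    0, and [q] is chosen so that it contains [z]. *)
Lemma Fc_eval_continuous (R : realType) (L z : R) :
  continuous (fun f : Fc L => f z).
Proof.
move=> f; apply/(@cvgrPdist_lt _ _ _ _ (nbhs_filter f)) => e e0.
pose q := (Num.truncn `|z|).+1.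
have zq : `|z| <= q%:R by rewrite ltW// truncnS_gt.
have m0 : 0 < Num.min 1 e by rewrite lt_min ltr01.
have p0 n : 0 < 2 ^- n :> R by rewrite invr_gt0 exprn_gt0.
apply: filterS (nbhs_mdist f (mulr_gt0 (p0 q) m0)) => g.
pose a r : R := 2 ^- r * Num.min 1 (sup_dist [set z | `|z| <= r%:R] f g).
have a0 r : 0 <= a r <= 2 ^- r.
  have /andP[s0 s1] := min1_ge0 (sup_dist_ge0 [set z | `|z| <= r%:R] f g).
  by rewrite mulr_ge0// ?(ltW (p0 _))//= ler_piMr// ltW.
have aq : a q <= Fc_dist f g by exact: dyadic_sum_ge_term.
move=> /(le_lt_trans aq); rewrite ltr_pM2l// => /min1_lt.
rewrite ge_min lexx => /(_ isT); rewrite lt_min => /andP[_]; apply: le_lt_trans.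
exact: sup_dist_ub (Fc_loc_bounded f q) (Fc_loc_bounded g q) zq.
Qed.

Lemma Fne_eval_continuous (R : realType) (z : R) :
  continuous (fun f : Fne R => f z).
Proof.
move=> f; apply/(@cvgrPdist_lt _ _ _ _ (nbhs_filter f)) => e e0.
apply: filterS (nbhs_mdist f e0) => g.
by apply: le_lt_trans; exact: sup_dist_ub (Fne_loc_bounded f) (Fne_loc_bounded g) I.
Qed.

Lemma Fne_sup_le (R : realType) (f g : Fne R) :
  Fne_sup f <= Fne_sup g + Fne_dist f g.
Proof.
apply: ge_sup; first by exists (f 0), 0.
move=> _ [z _ <-].
have gz : g z <= Fne_sup g.
  apply: ub_le_sup; last by exists z.
  have [M gM] := Fne_loc_bounded g; exists M => _ [y _ <-].
  exact: le_trans (ler_norm _) (gM y I).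
have fgz : f z - g z <= Fne_dist f g.
  apply: le_trans (ler_norm _) _.
  exact: sup_dist_ub (Fne_loc_bounded f) (Fne_loc_bounded g) I.
by rewrite -[f z](subrK (g z)) addrC lerD.
Qed.

Lemma Fne_sup_continuous (R : realType) : continuous (@Fne_sup R).
Proof.
move=> f; apply/(@cvgrPdist_lt _ _ _ _ (nbhs_filter f)) => e e0.
apply: filterS (nbhs_mdist f e0) => g.
apply: le_lt_trans.
rewrite -[mdist f g]/(Fne_dist f g) ler_distl lerBlDr Fne_sup_le andbT.
by rewrite Fne_dist_sym Fne_sup_le.
Qed.

(** * Continuity in both regimes *)

Theorem lemmaA3 (R : realType) (T : topologicalType)
    (dT : complete_metric R T) (hT : separable T) :
  (forall (L : R), 0 <= L < 1 ->
    forall (d : complete_metric R (T * R * Fc L)%type) (k : nat),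
    exists Phi : Gtilde d -> R,
      (forall g : mgraph R (T * R * Fc L),
        Phi (net_class d g) =
        state (@Fc_fun R L) (fun _ => 0) k (origin g)) /\
      continuous Phi) /\
  (forall (d : complete_metric R (T * R * Fne R)%type) (k : nat),
    exists PhiM PhiP : Gtilde d -> R,
      (forall g : mgraph R (T * R * Fne R),
        PhiM (net_class d g) =
        state (@Fne_fun R) (fun _ => 0) k (origin g)) /\
      continuous PhiM /\
      (forall g : mgraph R (T * R * Fne R),
        PhiP (net_class d g) =
        state (@Fne_fun R) (@Fne_sup R) k (origin g)) /\
      continuous PhiP).
Proof.
split=> [L _ d k|d k].
  apply: root_functional; last exact: cst_continuous.
  apply: (equilipschitz_joint_continuous (L := L)) => [f|].
    exact: Fc_lipschitz.
  exact: Fc_eval_continuous.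
have cresp : continuous (fun z : Fne R * R => z.1 z.2).
  apply: (equilipschitz_joint_continuous (L := 1)) => [f|].
    exact: Fne_lipschitz.
  exact: Fne_eval_continuous.
have [PhiM [PhiME PhiMc]] := root_functional (init := fun=> 0) d k cresp
  (@cst_continuous _ _ 0).
have [PhiP [PhiPE PhiPc]] := root_functional d k cresp (@Fne_sup_continuous R).
by exists PhiM, PhiP.
Qed.
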